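(* There is a strictly convex real Banach space of density continuum with no uncountable Auerbach system.
   Context: The density of an infinite dimensional Banach space is the minimal cardinality of a norm dense subset. For a Banach space $\mathcal{X}$ with dual $\mathcal{X}^*$, a system $(x_i,x_i^* )_{i\in I}\subseteq\mathcal{X}\times\mathcal{X}^*$ is biorthogonal if $x_j^*(x_i)=0$ for $i\ne j$ and $x_i^*(x_i)=1$ for all $i,j\in I$. It is an Auerbach system if it is biorthogonal and $\|x_i\|=1=\|x_i^*\|$ for every $i\in I$. It is uncountable if $I$ is uncountable. A norm is strictly convex if $\|x+y\|=\|x\|+\|y\|$ for nonzero $x,y$ implies $x=\lambda y$ for some $\lambda>0$. *)

(* Defs.v *)
From HB Require Import structures.
From mathcomp Require Import all_boot all_order all_algebra.
From mathcomp Require Import all_classical all_reals all_analysis.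

Set Implicit Arguments.
Unset Strict Implicit.
Unset Printing Implicit Defensive.

Import Order.TTheory GRing.Theory Num.Theory.
Import numFieldNormedType.Exports.

Local Open Scope classical_set_scope.
Local Open Scope ring_scope.
Local Open Scope card_scope.

(* The minimal cardinality of a dense subset of [X] is the cardinality
   of [K]. *)
Definition has_density (X : topologicalType) (T : Type) (K : set T) : Prop :=
  (exists D : set X, dense D /\ D #= K) /\
  (forall D : set X, dense D -> K #<= D).

(* The target [R^o] is [R] seen as a normed space over itself, so that
   continuous terms of [{linear X -> R^o}] are the elements of the dual. *)
Definition dual_norm (R : realType) (X : normedModType R)
    (f : {linear X -> R^o}) : R :=
  sup [set `|f x| | x in [set x : X | `|x| <= 1]].

Definition biorthogonal (R : realType) (X : normedModType R) (I : Type)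
    (x : I -> X) (f : I -> {linear X -> R^o}) : Prop :=
  [/\ forall i, continuous (f i),
      forall i j, i <> j -> f j (x i) = 0 &
      forall i, f i (x i) = 1].

Definition auerbach_system (R : realType) (X : normedModType R) (I : Type)
    (x : I -> X) (f : I -> {linear X -> R^o}) : Prop :=
  biorthogonal x f /\ forall i, `|x i| = 1 /\ dual_norm (f i) = 1.

Definition strictly_convex_norm (R : realType) (X : normedModType R) : Prop :=
  forall x y : X, x != 0 -> y != 0 -> `|x + y| = `|x| + `|y| ->
  exists2 lambda : R, 0 < lambda & x = lambda *: y.

(* Main.v *)
(* The space is the Johnson-Lindenstrauss space of the branches of the binary
   tree: bounded functions on the nodes that are uniform limits of combinations
   of indicator functions of branches and of nodes, with the norm
   |x| = sup_norm x + hnorm x, where hnorm is a weighted l2 norm, so that the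
   norm is strictly convex.  Up to a small error, x is described by a finite
   initial part of the tree and, below each node of some level L, by one branch
   and one real number.  If x and y in the unit sphere agree on the initial part
   and on these numbers, then x - y is below level L close to a function with
   values 0, r or -r, with |r| <= sup_norm x, whence
   |x - y| <= sup_norm x + small = 1 - hnorm x + small < 1.  Hence the unit
   sphere is a countable union of sets without 1-separated pairs, whereas the
   vectors of an Auerbach system satisfy 1 = f_i (x_i - x_j) <= |x_i - x_j|. *)
Require Import Defs.
From HB Require Import structures.
From mathcomp Require Import all_boot all_order all_algebra.
From mathcomp Require Import all_classical all_reals all_analysis.
From mathcomp Require Import lra ring.

Import Order.TTheory GRing.Theory Num.Theory.
Import numFieldNormedType.Exports.

Local Open Scope classical_set_scope.
Local Open Scope ring_scope.

Set Implicit Arguments.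
Unset Strict Implicit.
Unset Printing Implicit Defensive.

(** * Series weighted by powers of one third; binary sequences as reals *)

Section TernarySum.
Context {R : realType}.
Implicit Types (c d : nat -> R) (B : R) (n M : nat).

Definition bnd (T : Type) (c : T -> R) := exists B, forall k, `|c k| <= B.

Lemma bndD (T : Type) (c d : T -> R) : bnd c -> bnd d -> bnd (c + d).
Proof.
move=> [B cB] [D dD]; exists (B + D) => k.
by rewrite (le_trans (ler_normD _ _))// lerD.
Qed.

Lemma bndM (T : Type) (c d : T -> R) : bnd c -> bnd d -> bnd (c * d).
Proof.
move=> [B cB] [D dD]; exists (B * D) => k.
by rewrite normrM ler_pM.
Qed.

Lemma bndZ (T : Type) a (c : T -> R) : bnd c -> bnd (a *: c).
Proof.
by move=> [B cB]; exists (`|a| * B) => k; rewrite normrM ler_wpM2l.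
Qed.

Definition ternary_term c : nat -> R := fun k => 3^-1 ^+ k * c k.

Definition ternary_sum c : R := limn (series (ternary_term c)).

Lemma ternary_termD c d :
  ternary_term (c + d) = ternary_term c + ternary_term d.
Proof. by apply/funext => k; rewrite /ternary_term mulrDr. Qed.

Lemma ternary_termZ a c : ternary_term (a *: c) = a *: ternary_term c.
Proof. by apply/funext => k; rewrite /ternary_term mulrCA. Qed.

Lemma is_cvg_ternary c : bnd c -> cvgn (series (ternary_term c)).
Proof.
move=> [B cB]; apply: normed_cvg => /=.
apply: (@series_le_cvg _ _ (geometric B (3^-1 : R))) => [n|n|n|] /=.
- by [].
- by rewrite mulr_ge0 ?exprn_ge0 ?invr_ge0// (le_trans _ (cB n)).
- rewrite /ternary_term normrM mulrC ler_pM//.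
  by rewrite ger0_norm// exprn_ge0 ?invr_ge0.
- apply: is_cvg_geometric_series; rewrite ger0_norm ?invr_ge0//; lra.
Qed.

Lemma ternary_sumD c d : bnd c -> bnd d ->
  ternary_sum (c + d) = ternary_sum c + ternary_sum d.
Proof.
move=> bc bd; rewrite /ternary_sum ternary_termD.
by rewrite lim_seriesD//; exact: is_cvg_ternary.
Qed.

Lemma ternary_sumZ a c : bnd c -> ternary_sum (a *: c) = a * ternary_sum c.
Proof.
move=> bc; rewrite /ternary_sum ternary_termZ lim_seriesZ//.
exact: is_cvg_ternary.
Qed.

Lemma ler_ternary_sum c d : bnd c -> bnd d -> (forall k, c k <= d k) ->
  ternary_sum c <= ternary_sum d.
Proof.
move=> bc bd cd; apply: lim_series_le; [exact: is_cvg_ternary..|] => k.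
by rewrite /ternary_term ler_wpM2l// exprn_ge0 ?invr_ge0.
Qed.

Lemma ternary_sum0 : ternary_sum 0 = 0.
Proof.
rewrite -[X in ternary_sum X](scale0r 0) ternary_sumZ ?mul0r//.
by exists 0 => k; rewrite normr0.
Qed.

Lemma ternary_sum_ge0 c : bnd c -> (forall k, 0 <= c k) -> 0 <= ternary_sum c.
Proof.
move=> bc c0; rewrite -ternary_sum0 ler_ternary_sum//.
by exists 0 => k; rewrite normr0.
Qed.

Lemma bnd_tail M : bnd (fun k => (M <= k)%N%:R : R).
Proof. by exists 1 => k; case: leqP => _; rewrite ?normr1 ?normr0. Qed.

(** Tails serve as test sequences: those from [n] and [n.+1] differ only at [n], so comparing sums
    against them isolates one coordinate. *)
Lemma ternary_sum_tail M :
  ternary_sum (fun k => (M <= k)%N%:R) = 3^-1 ^+ M * (3 / 2).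
Proof.
have E n : series (ternary_term (fun k => (M <= k)%N%:R)) (M + n)%N =
    3^-1 ^+ M * (3 / 2) - 3^-1 ^+ (M + n) * (3 / 2).
  elim: n => [|n IH].
    rewrite addn0 subrr /series/= big_nat_cond big1// => i /andP[/andP[_ iM] _].
    by rewrite /ternary_term leqNgt iM mulr0.
  rewrite addnS /series/= big_nat_recr ?leq0n//=.
  move: IH; rewrite /series/= => ->.
  by rewrite /ternary_term leq_addr mulr1 exprS; lra.
have lim0 : (3^-1 : R) ^+ n @[n --> \oo] --> (0 : R).
  by apply: cvg_expr; rewrite ger0_norm ?invr_ge0//; lra.
apply/cvg_lim => //; rewrite -(cvg_shiftn M).
have -> : 3^-1 ^+ M * (3 / 2) = 3^-1 ^+ M * (3 / 2) - 0 * (3 / 2) :> R by lra.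
under eq_fun do rewrite addnC E.
apply: cvgB; first exact: cvg_cst.
apply: cvgMr_tmp; move: lim0; rewrite -(cvg_shiftn M).
by under eq_fun do rewrite addnC.
Qed.

(* The weights [3^-k] make the coordinate where two binary sequences first
   differ dominate all later ones. *)
Definition binary_sum (s : nat -> bool) : R := ternary_sum (fun k => (s k)%:R).

Lemma binary_sum_inj : injective binary_sum.
Proof.
have bb (s : nat -> bool) : bnd (fun k => (s k)%:R : R).
  by exists 1 => k; case: (s k); rewrite ?normr1 ?normr0.
have lt_sum (s t : nat -> bool) n : (forall k, (k < n)%N -> s k = t k) ->
    s n -> ~~ t n -> binary_sum t < binary_sum s.
  move=> st sn tn; set e := fun m k => (m <= k)%N%:R : R.
  (* Termwise, both sides are 1 at [n], and beyond [n] the left is at most 2. The tails sum to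
     [3^-n * (3 / 2)] and [3^-n], which leaves a gap of [3^-n / 2] between the two binary sums. *)
  have: ternary_sum (e n + (fun k => (t k)%:R)) <=
        ternary_sum (2 *: e n.+1 + (fun k => (s k)%:R)).
    apply: ler_ternary_sum => [||k].
    - exact: bndD (bnd_tail _) (bb _).
    - by apply: bndD (bb _); exact/bndZ/bnd_tail.
    - change (e n k + (t k)%:R <= 2 * e n.+1 k + (s k)%:R :> R); rewrite /e.
      have [kn|nk|->] := ltngtP k n.
      + by rewrite st// !mulr0n; lra.
      + by case: (s k) (t k) => -[]; rewrite ?mulr1n ?mulr0n; lra.
      + by rewrite sn (negbTE tn) !mulr1n !mulr0n; lra.
  rewrite !ternary_sumD ?ternary_sumZ ?ternary_sum_tail -/(binary_sum _)//;
    try solve [exact: bnd_tail | exact/bndZ/bnd_tail].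
  rewrite exprS; have: 0 < (3^-1 : R) ^+ n by rewrite exprn_gt0 ?invr_gt0.
  rewrite /binary_sum; lra.
move=> s t est; apply/funext; apply: contrapT => /existsNP[m stm].
have /ex_minnP[n stn minn] : exists m, s m != t m by exists m; apply/eqP.
have eqst k : (k < n)%N -> s k = t k.
  by move=> kn; apply: contraTeq kn => /minn; rewrite -leqNgt.
have [sn|sn] := boolP (s n).
  have tn : ~~ t n by apply: contraNN stn => tn; rewrite sn tn.
  by have := lt_sum _ _ _ eqst sn tn; rewrite est ltxx.
have tn : t n by apply: contraNT stn => tn; rewrite (negbTE sn) (negbTE tn).
by have := lt_sum _ _ _ (fun k kn => esym (eqst k kn)) tn sn; rewrite est ltxx.
Qed.

End TernarySum.

(** * The binary tree and approximation by branches *)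

Section Tree.
Context {R : realType}.
Implicit Types (s : nat -> bool) (t u v : seq bool) (x y : seq bool -> R).

Definition on_branch s u := u == mkseq s (size u).

Lemma on_branchP s u :
  reflect (forall i, (i < size u)%N -> nth false u i = s i) (on_branch s u).
Proof.
apply: (iffP eqP) => [-> i|H]; first by rewrite size_mkseq => ?; rewrite nth_mkseq.
apply: (@eq_from_nth _ false); rewrite ?size_mkseq// => i iu.
by rewrite nth_mkseq// H.
Qed.

Lemma on_branch_catl s t v : on_branch s (t ++ v) -> on_branch s t.
Proof.
move=> /on_branchP H; apply/on_branchP => i it; rewrite -H ?nth_cat ?it//.
by rewrite size_cat ltn_addr.
Qed.

Lemma on_branch_nth t : on_branch (nth false t) t.
Proof. by apply/on_branchP. Qed.

Lemma on_branch_disjoint s s' : s <> s' ->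
  exists n, forall u, (n <= size u)%N -> ~~ (on_branch s u && on_branch s' u).
Proof.
move=> ss'; have [m sm] : exists m, s m <> s' m.
  by apply: contra_notP ss' => /forallNP H; apply/funext => m; exact: contrapT.
exists m.+1 => u um; apply/negP => /andP[/on_branchP/(_ _ um) + /on_branchP/(_ _ um)].
by move=> -> /sm.
Qed.

(** Only finitely many nodes have size at most [L]; the induction passes to the two subtrees of the
    root. *)
Lemma bounded_on_levels (f : seq bool -> nat) L :
  exists M, forall t, (size t <= L)%N -> (f t <= M)%N.
Proof.
elim: L f => [|L IH] f; first by exists (f [::]) => -[].
have [M HM] := IH (fun t => f (true :: t)).
have [N HN] := IH (fun t => f (false :: t)).
exists (maxn (f [::]) (maxn M N)) => -[|[] t] /=; first by rewrite leq_maxl.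
- by move=> /HM H; rewrite !leq_max H orbT.
- by move=> /HN H; rewrite !leq_max H !orbT.
Qed.

(* Requiring this for every [e > 0], with [L] depending on [e], describes the
   closed span of the indicator functions of branches and of nodes. *)
Definition tree_approx x (e : R) L := forall t, size t = L ->
  exists s (r : R), on_branch s t /\
    forall v, `|x (t ++ v) - r * (on_branch s (t ++ v))%:R| <= e.

Lemma tree_approx_mono x e L L' : (L <= L')%N ->
  tree_approx x e L -> tree_approx x e L'.
Proof.
move=> LL' H t tL'; have [|s [r [_ Hr]]] := H (take L t).
  by rewrite size_takel// tL'.
have [st|st] := boolP (on_branch s t).
  by exists s, r; split=> // v; have := Hr (drop L t ++ v); rewrite catA cat_take_drop.
(* The branch misses [t], so [x] is within [e] of 0 below [t], and the zero multiple of any branch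
   through [t] will do; [nth false t] continues [t] by [false]. *)
exists (nth false t), 0; split; first exact: on_branch_nth.
move=> v; have := Hr (drop L t ++ v); rewrite catA cat_take_drop mul0r.
by rewrite (negbTE (contraNN (@on_branch_catl s t v) st)) mulr0.
Qed.

Lemma tree_approx_choice x e L : tree_approx x e L ->
  exists f : seq bool -> (nat -> bool) * R, forall t, size t = L ->
    forall v, `|x (t ++ v) - (f t).2 * (on_branch (f t).1 (t ++ v))%:R| <= e.
Proof.
move=> Hx; have /choice[f Hf] : forall t, exists p : (nat -> bool) * R,
    size t = L -> forall v,
    `|x (t ++ v) - p.2 * (on_branch p.1 (t ++ v))%:R| <= e.
  move=> t; have [/Hx[s [r [_ H]]]|tL] := pselect (size t = L).
    by exists (s, r).
  by exists (fun=> true, 0).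
by exists f.
Qed.

(** Below a node of level [L] the sum is close to a combination of two branches. Unless they are
    equal, they have separated far enough down, so that each deep node lies on at most one of
    them. *)
Lemma tree_approxD x y e d L : tree_approx x e L -> tree_approx y d L ->
  exists L', tree_approx (x + y) (e + d) L'.
Proof.
move=> Hx Hy.
have [f Hf] := tree_approx_choice Hx; have [g Hg] := tree_approx_choice Hy.
have /choice[n Hn] : forall t, exists k, (f t).1 <> (g t).1 ->
    forall u, (k <= size u)%N -> ~~ (on_branch (f t).1 u && on_branch (g t).1 u).
  move=> t; have [/on_branch_disjoint[k H]|H] := pselect ((f t).1 <> (g t).1).
    by exists k.
  by exists 0%N.
(* A separation depth common to all nodes up to level [L]. *)
have [M HM] := bounded_on_levels n L.
exists (maxn L M) => t' t'L; set t := take L t'.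
have tL : size t = L by rewrite size_takel// t'L leq_maxl.
have t'E v : t' ++ v = t ++ (drop L t' ++ v) by rewrite catA cat_take_drop.
suff [s [r [st' Hsr]]] : exists s (r : R), on_branch s t' /\ forall v,
    (f t).2 * (on_branch (f t).1 (t' ++ v))%:R +
    (g t).2 * (on_branch (g t).1 (t' ++ v))%:R =
    r * (on_branch s (t' ++ v))%:R.
  exists s, r; split=> // v; rewrite -Hsr.
  rewrite [(x + y) _]/(x _ + y _) opprD addrACA.
  by rewrite (le_trans (ler_normD _ _))// lerD// !t'E; [exact: Hf|exact: Hg].
have off s v : ~~ on_branch s t' -> on_branch s (t' ++ v) = false.
  by move=> st'; apply/negbTE; apply: contraNN st'; exact: on_branch_catl.
have [ft|ft] := boolP (on_branch (f t).1 t'); last first.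
  have [gt|gt] := boolP (on_branch (g t).1 t'); last first.
    exists (nth false t'), 0; split; first exact: on_branch_nth.
    by move=> v; rewrite (off _ _ ft) (off _ _ gt) !mulr0 mul0r addr0.
  by exists (g t).1, (g t).2; split=> // v; rewrite (off (f t).1)// mulr0n mulr0 add0r.
have [gt|gt] := boolP (on_branch (g t).1 t'); last first.
  by exists (f t).1, (f t).2; split=> // v; rewrite (off (g t).1)// mulr0n mulr0 addr0.
exists (f t).1, ((f t).2 + (g t).2); split=> // v.
suff <- : (f t).1 = (g t).1 by rewrite mulrDl.
apply: contrapT => /Hn/(_ t'); rewrite ft gt => H.
suff: ~~ true by [].
by apply: H; rewrite t'L (leq_trans (HM _ _)) ?tL ?leq_maxr.
Qed.

Lemma tree_approxZ a x e L : tree_approx x e L -> tree_approx (a *: x) (`|a| * e) L.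
Proof.
move=> H t /H[s [r [st Hr]]]; exists s, (a * r); split=> // v.
by rewrite -mulrA -mulrBr normrM ler_wpM2l.
Qed.

Lemma tree_approx_near x y e d L : (forall u, `|y u - x u| <= d) ->
  tree_approx x e L -> tree_approx y (d + e) L.
Proof.
move=> yx H t /H[s [r [st Hr]]]; exists s, r; split=> // v.
by rewrite -(subrKA (x (t ++ v))) (le_trans (ler_normD _ _))// lerD.
Qed.

Definition branching x := forall e : R, 0 < e -> exists L, tree_approx x e L.

Lemma branchingD x y : branching x -> branching y -> branching (x + y).
Proof.
move=> bx bY e e0; have e2 : 0 < e / 2 by rewrite divr_gt0.
have [[L Lx] [L' Ly]] := (bx _ e2, bY _ e2).
rewrite (splitr e); apply: (@tree_approxD _ _ _ _ (maxn L L')).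
- exact: tree_approx_mono (leq_maxl _ _) Lx.
- exact: tree_approx_mono (leq_maxr _ _) Ly.
Qed.

Lemma branchingZ a x : branching x -> branching (a *: x).
Proof.
(* Adding 1 keeps the divisor positive when [a] is 0. *)
move=> bx e e0; have a0 : 0 < `|a| + 1 by rewrite ltr_wpDl.
have d0 : 0 < e / (`|a| + 1) by rewrite divr_gt0.
have [L Lx] := bx _ d0; exists L => t /(tree_approxZ a Lx)[s [r [st H]]].
exists s, r; split=> // v; rewrite (le_trans (H v))//.
by rewrite mulrCA ger_pMr// ler_pdivrMr// mul1r lerDl.
Qed.

Lemma branching_indic s : branching (fun u => (on_branch s u)%:R).
Proof.
move=> e e0; exists 0%N => -[]// _; exists s, 1; split=> // v.
by rewrite mul1r subrr normr0 ltW.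
Qed.

End Tree.

(** * The sup norm and the weighted l2 norm *)

Section Norms.
Context {R : realType}.
Implicit Types (x y z : seq bool -> R) (u : seq bool).

Definition sup_norm x : R := sup (range (fun u => `|x u|)).

Lemma le_sup_norm x u : bnd x -> `|x u| <= sup_norm x.
Proof.
by move=> [B xB]; apply: ub_le_sup; [exists B => _ [v _ <-]|exists u].
Qed.

Lemma sup_norm_le x B : (forall u, `|x u| <= B) -> sup_norm x <= B.
Proof.
move=> xB; apply: ge_sup => [|_ [u _ <-]//].
by exists `|x [::]|, [::].
Qed.

Lemma sup_norm_ge0 x : bnd x -> 0 <= sup_norm x.
Proof. by move=> bx; rewrite (le_trans _ (le_sup_norm [::] bx)). Qed.

Lemma sup_normD x y : bnd x -> bnd y ->
  sup_norm (x + y) <= sup_norm x + sup_norm y.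
Proof.
move=> bx bY; apply: sup_norm_le => u.
by rewrite (le_trans (ler_normD _ _))// lerD// le_sup_norm.
Qed.

Lemma sup_normZ a x : bnd x -> sup_norm (a *: x) = `|a| * sup_norm x.
Proof.
move=> bx; have [->|a0] := eqVneq a 0.
  rewrite normr0 mul0r scale0r; apply/le_anti/andP; split.
    by apply: sup_norm_le => u; rewrite normr0.
  by apply: sup_norm_ge0; exists 0 => u; rewrite normr0.
apply/le_anti/andP; split.
  by apply: sup_norm_le => u; rewrite normrM ler_wpM2l// le_sup_norm.
rewrite -ler_pdivlMl ?normr_gt0//; apply: sup_norm_le => u.
by rewrite ler_pdivlMl ?normr_gt0// -normrM; exact/(le_sup_norm u)/bndZ.
Qed.

(** Nodes are enumerated by [choice.pickle]; an index that codes no node gets 0 and contributes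
    nothing to the weighted sums. *)
Definition coord x : nat -> R := fun k => oapp x 0 (choice.unpickle k).

Lemma coord_pickle x u : coord x (choice.pickle u) = x u.
Proof. by rewrite /coord choice.pickleK. Qed.

Lemma coordD x y : coord (x + y) = coord x + coord y.
Proof.
apply/funext => k; change (coord (x + y) k = coord x k + coord y k).
by rewrite /coord; case: choice.unpickle => //=; rewrite addr0.
Qed.

Lemma coordZ a x : coord (a *: x) = a *: coord x.
Proof.
apply/funext => k; change (coord (a *: x) k = a * coord x k).
by rewrite /coord; case: choice.unpickle => //=; rewrite mulr0.
Qed.

Lemma coord_le x B k : 0 <= B -> (forall u, `|x u| <= B) -> `|coord x k| <= B.
Proof. by rewrite /coord; case: choice.unpickle => //=; rewrite normr0. Qed.

Lemma bnd_coord x : bnd x -> bnd (coord x).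
Proof.
move=> [B xB]; exists B => k; apply: coord_le => //.
exact: le_trans (xB [::]).
Qed.

Definition inner x y : R := ternary_sum (coord x * coord y).

Lemma innerC x y : inner x y = inner y x.
Proof. by rewrite /inner mulrC. Qed.

Lemma innerDl x y z : bnd x -> bnd y -> bnd z ->
  inner (x + y) z = inner x z + inner y z.
Proof.
by move=> bx bY bz; rewrite /inner coordD mulrDl ternary_sumD//;
  apply: bndM; exact: bnd_coord.
Qed.

Lemma innerZl a x y : bnd x -> bnd y -> inner (a *: x) y = a * inner x y.
Proof.
move=> bx bY; rewrite /inner coordZ -ternary_sumZ; last first.
  by apply: bndM; exact: bnd_coord.
by congr ternary_sum; apply/funext => k; exact: esym (mulrA _ _ _).
Qed.

Lemma innerDr x y z : bnd x -> bnd y -> bnd z ->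
  inner z (x + y) = inner z x + inner z y.
Proof. by move=> *; rewrite innerC innerDl// ![inner _ z]innerC. Qed.

Lemma innerZr a x y : bnd x -> bnd y -> inner x (a *: y) = a * inner x y.
Proof. by move=> *; rewrite innerC innerZl// innerC. Qed.

Lemma inner_ge0 x : bnd x -> 0 <= inner x x.
Proof.
move=> bx; apply: ternary_sum_ge0 => [|k]; first by apply: bndM; exact: bnd_coord.
by change (0 <= coord x k * coord x k); rewrite -expr2 sqr_ge0.
Qed.

Lemma inner_eq0 x : bnd x -> inner x x = 0 -> x = 0.
Proof.
move=> bx xx0; apply/funext => u; set k : nat := choice.pickle u.
have bxx : bnd (coord x * coord x) by apply: bndM; exact: bnd_coord.
set a := (x u) ^+ 2; set e := fun m k => (m <= k)%N%:R : R.
(* The two tails differ only at [k], where the square of [coord x] is [a]. As [inner x x = 0],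
   summing gives [a * (3 / 2) <= a / 2] up to the factor [3^-1 ^+ k], so [a = 0]. *)
have : ternary_sum (a *: e k) <= ternary_sum (a *: e k.+1 + coord x * coord x).
  apply: ler_ternary_sum => [||m]; first exact/bndZ/bnd_tail.
    by apply: bndD => //; exact/bndZ/bnd_tail.
  change (a * e k m <= a * e k.+1 m + coord x m * coord x m); rewrite /e.
  have cx : 0 <= coord x m * coord x m by rewrite -expr2 sqr_ge0.
  have [mk|mk|<-] := ltngtP k m.
  - by rewrite !mulr1n lerDl.
  - by rewrite !mulr0n !mulr0 add0r.
  - by rewrite mulr1n mulr0n mulr0 add0r mulr1 coord_pickle -expr2.
rewrite ternary_sumD//; last exact/bndZ/bnd_tail.
rewrite -/(inner x x) xx0 !ternary_sumZ; [|exact: bnd_tail..].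
rewrite !ternary_sum_tail exprS addr0 -subr_ge0 -mulrBr => H.
suff : a = 0 by move/eqP; rewrite /a sqrf_eq0 => /eqP.
apply/le_anti; rewrite sqr_ge0 andbT.
have : 0 < (3^-1 : R) ^+ k by rewrite exprn_gt0 ?invr_gt0.
move: H; set w := _ ^+ k => H w0.
have : 0 <= a * (- w) by lra.
by rewrite mulrN oppr_ge0 pmulr_lle0.
Qed.

Definition hnorm x : R := Num.sqrt (inner x x).

Lemma sqr_hnorm x : bnd x -> hnorm x ^+ 2 = inner x x.
Proof. by move=> bx; rewrite sqr_sqrtr// inner_ge0. Qed.

Lemma hnorm_ge0 x : 0 <= hnorm x. Proof. exact: sqrtr_ge0. Qed.

Lemma hnorm_eq0 x : bnd x -> hnorm x = 0 -> x = 0.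
Proof. by move=> bx x0; apply: inner_eq0; rewrite // -sqr_hnorm// x0 expr0n. Qed.

Lemma hnormZ a x : bnd x -> hnorm (a *: x) = `|a| * hnorm x.
Proof.
move=> bx; rewrite /hnorm innerZl ?innerZr//; last exact: bndZ.
by rewrite mulrA -expr2 sqrtrM ?sqr_ge0// sqrtr_sqr.
Qed.

(** Up to a factor this is the defect in Cauchy-Schwarz, so one identity serves both the inequality
    and its equality case. *)
Lemma inner_crossE x y : bnd x -> bnd y ->
  let z := hnorm y *: x + (- hnorm x) *: y in
  inner z z = 2 * (hnorm x * hnorm y) * (hnorm x * hnorm y - inner x y).
Proof.
move=> bx bY /=.
have [bx' by'] := (bndZ (hnorm y) bx, bndZ (- hnorm x) bY).
rewrite innerDl ?innerDr ?innerZl ?innerZr//; try exact: bndD.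
rewrite -!sqr_hnorm// (innerC y x); ring.
Qed.

Lemma cauchy_schwarz x y : bnd x -> bnd y -> inner x y <= hnorm x * hnorm y.
Proof.
move=> bx bY; have [x0|x0] := eqVneq (hnorm x) 0.
  have -> := hnorm_eq0 bx x0; rewrite -(scale0r (0 : seq bool -> R)).
  by rewrite innerZl// ?mul0r ?mulr_ge0 ?hnorm_ge0//; exists 0 => u; rewrite normr0.
have [y0|y0] := eqVneq (hnorm y) 0.
  have -> := hnorm_eq0 bY y0; rewrite -(scale0r (0 : seq bool -> R)) innerC.
  by rewrite innerZl// ?mul0r ?mulr_ge0 ?hnorm_ge0//; exists 0 => u; rewrite normr0.
have xy0 : 0 < hnorm x * hnorm y by rewrite mulr_gt0 ?lt_def ?x0 ?y0 ?hnorm_ge0.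
have := inner_crossE bx bY => /=; set z := _ + _ => zE.
have : 0 <= inner z z by apply/inner_ge0/bndD; exact: bndZ.
rewrite zE pmulr_rge0; last by rewrite mulr_gt0.
by rewrite subr_ge0.
Qed.

Lemma inner_addE x y : bnd x -> bnd y ->
  inner (x + y) (x + y) = hnorm x ^+ 2 + 2 * inner x y + hnorm y ^+ 2.
Proof.
move=> bx bY; rewrite innerDl ?innerDr//; try exact: bndD.
by rewrite !sqr_hnorm// (innerC y x); ring.
Qed.

Lemma hnormD x y : bnd x -> bnd y -> hnorm (x + y) <= hnorm x + hnorm y.
Proof.
move=> bx bY; rewrite -ler_sqr ?nnegrE ?addr_ge0 ?hnorm_ge0//.
rewrite sqr_hnorm ?inner_addE//; last exact: bndD.
by have := cauchy_schwarz bx bY; lra.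
Qed.

(** Expanding the square forces equality in Cauchy-Schwarz, so the vector of [inner_crossE]
    vanishes. *)
Lemma hnorm_strict x y : bnd x -> bnd y -> hnorm (x + y) = hnorm x + hnorm y ->
  hnorm y *: x = hnorm x *: y.
Proof.
move=> bx bY xy.
have : inner (x + y) (x + y) = (hnorm x + hnorm y) ^+ 2.
  by rewrite -xy sqr_hnorm//; exact: bndD.
rewrite inner_addE// => E.
have ixy : inner x y = hnorm x * hnorm y by lra.
apply/eqP; rewrite -subr_eq0 -scaleNr; apply/eqP/inner_eq0.
  by apply: bndD; exact: bndZ.
by rewrite inner_crossE// ixy subrr mulr0.
Qed.

(** The squared coordinates are dominated by [e ^+ 2] everywhere plus [B ^+ 2] from [M] on; [3 / 2]
    is the sum of all powers of one third. *)
Lemma inner_le x B e M : 0 <= e -> (forall u, `|x u| <= B) ->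
  (forall k, (k < M)%N -> `|coord x k| <= e) ->
  inner x x <= e ^+ 2 * (3 / 2) + B ^+ 2 * (3^-1 ^+ M * (3 / 2)).
Proof.
move=> e0 xB xe; have B0 : 0 <= B by exact: le_trans (xB [::]).
have bx : bnd (coord x) by exists B => k; exact: coord_le.
rewrite -ternary_sum_tail -[3 / 2]mul1r -[X in X * (3 / 2)](expr0 3^-1).
rewrite -ternary_sum_tail -!ternary_sumZ -?ternary_sumD;
  try solve [exact: bnd_tail | exact/bndZ/bnd_tail].
apply: ler_ternary_sum; first exact: bndM.
  by apply: bndD; exact/bndZ/bnd_tail.
move=> k; change (coord x k * coord x k <=
  e ^+ 2 * (0 <= k)%N%:R + B ^+ 2 * (M <= k)%N%:R).
have [Mk|kM] := leqP M k.
  rewrite !mulr1 ler_wpDl ?sqr_ge0// -expr2 -real_normK ?num_real//.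
  by rewrite lerXn2r ?nnegrE//; exact: coord_le.
rewrite mulr1 mulr0 addr0 -expr2 -real_normK ?num_real//.
by rewrite lerXn2r ?nnegrE//; exact: xe.
Qed.

Lemma hnorm_le x B : (forall u, `|x u| <= B) -> hnorm x <= 2 * B.
Proof.
move=> xB; have B0 : 0 <= B by exact: le_trans (xB [::]).
have := @inner_le x B 0 0 (lexx 0) xB (fun k => ltac:(by [])).
rewrite expr0n expr0 mul0r add0r mul1r => H.
rewrite -[leRHS]ger0_norm ?mulr_ge0// -sqrtr_sqr ler_wsqrtr// (le_trans H)//.
by rewrite exprMn; have := sqr_ge0 B; lra.
Qed.

End Norms.

(** * The Johnson-Lindenstrauss space and its completeness *)

Section Space.
Context {R : realType}.

Definition jl_pred : {pred seq bool -> R} := fun x => `[< bnd x /\ branching x >].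

Lemma jl_predP x : reflect (bnd x /\ branching x) (x \in jl_pred).
Proof. exact: asboolP. Qed.

Lemma jl_submod_closed : submod_closed jl_pred.
Proof.
split=> [|a x y /jl_predP[bx Bx] /jl_predP[bY By]]; apply/jl_predP; split.
- by exists 0 => u; rewrite normr0.
- move=> e e0; exists 0%N => t _; exists (nth false t), 0.
  split; first exact: on_branch_nth.
  by move=> v; rewrite mul0r subrr normr0 ltW.
- by apply: bndD => //; exact: bndZ.
- by apply: branchingD => //; exact: branchingZ.
Qed.

HB.instance Definition _ := GRing.isSubmodClosed.Build R (seq bool -> R)
  jl_pred jl_submod_closed.

Record jl := JL { jl_fun :> seq bool -> R; _ : jl_fun \in jl_pred }.

HB.instance Definition _ := [isSub for jl_fun].
HB.instance Definition _ := [Choice of jl by <:].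
HB.instance Definition _ := [SubChoice_isSubLmodule of jl by <:].

Lemma bnd_jl (x : jl) : bnd x. Proof. by case: x => /= x xjl; have /jl_predP[] := xjl. Qed.

Lemma branching_jl (x : jl) : branching x. Proof. by case: x => /= x xjl; have /jl_predP[] := xjl. Qed.

Definition jl_norm (x : jl) : R := sup_norm x + hnorm x.

Lemma jl_normD x y : jl_norm (x + y) <= jl_norm x + jl_norm y.
Proof.
have [bx bY] := (bnd_jl x, bnd_jl y).
by rewrite /jl_norm addrACA lerD ?sup_normD ?hnormD.
Qed.

Lemma jl_normZ a x : jl_norm (a *: x) = `|a| * jl_norm x.
Proof.
by rewrite /jl_norm mulrDr -sup_normZ -?hnormZ//; exact: bnd_jl.
Qed.

Lemma jl_norm_eq0 x : jl_norm x = 0 -> x = 0.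
Proof.
move=> x0; apply/val_inj/hnorm_eq0; first exact: bnd_jl.
have := sup_norm_ge0 (bnd_jl x); have := hnorm_ge0 x.
by move: x0; rewrite /jl_norm; lra.
Qed.

HB.instance Definition _ :=
  Lmodule_isNormed.Build R jl jl_normD jl_normZ jl_norm_eq0.

Lemma jl_normE (x : jl) : `|x| = sup_norm x + hnorm x. Proof. by []. Qed.

Lemma jl_norm_ge (x : jl) u : `|x u| <= `|x|.
Proof.
by rewrite jl_normE ler_wpDr ?hnorm_ge0// le_sup_norm//; exact: bnd_jl.
Qed.

(** With [jl_norm_ge], the norm is equivalent to the sup norm, so completeness reduces to uniform
    convergence. *)
Lemma jl_norm_le (x : jl) B : (forall u, `|x u| <= B) -> `|x| <= 3 * B.
Proof.
move=> xB; have := sup_norm_le xB; have := hnorm_le xB.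
rewrite jl_normE; lra.
Qed.

Lemma jl_complete (F : set_system jl) : ProperFilter F -> cauchy F -> cvg F.
Proof.
move=> FF /cauchy_ballP cF.
have cFu u : cvg ((fun x : jl => x u) @ F).
  apply/cauchy_cvgP/cauchy_ballP => e e0.
  rewrite near_map2; have [[A B] /= FAB AB] := cF e e0; exists (A, B) => //= -[x y] xy.
  have := AB _ xy; rewrite -!ball_normE /ball_/=.
  exact: le_lt_trans (jl_norm_ge (x - y) u).
pose l u : R := lim ((fun x : jl => x u) @ F).
(* The convergence is uniform: for [x] in [A], the Cauchy bound on [x - y] passes to the limit in
   [y] along [F]. *)
have Fl (e : R) : 0 < e -> \forall x \near F, forall u, `|(x : jl) u - l u| <= e.
  move=> e0; have [[A B] /= [FA FB] AB] := cF e e0.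
  apply: (@filterS _ F _ A) => // x Ax u.
  have xl : `|x u - (y : jl) u| @[y --> F] --> `|x u - l u|.
    by apply: cvg_norm; apply: cvgB; [exact: cvg_cst|exact: cFu].
  rewrite -(cvg_lim _ xl)//; apply: limr_le; first exact: cvgP xl.
  apply: (@filterS _ F _ B) => // y By; have := AB (x, y) (conj Ax By).
  rewrite -ball_normE /ball_/= => /ltW; exact: le_trans (jl_norm_ge (x - y) u).
have ll : l \in jl_pred.
  apply/jl_predP; split.
    have [x xl] := filter_ex (Fl _ ltr01); have [B xB] := bnd_jl x.
    exists (1 + B) => u; rewrite -(subrK (x u) (l u)) (le_trans (ler_normD _ _))//.
    by rewrite lerD// distrC.
  move=> e e0; have e2 : 0 < e / 2 by rewrite divr_gt0.
  have [x xl] := filter_ex (Fl _ e2).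
  have [L Lx] := branching_jl x e2; exists L; rewrite (splitr e).
  by apply: tree_approx_near Lx => u; rewrite distrC.
apply/cvg_ex; exists (JL ll); apply/cvgrPdist_le => e e0.
have e3 : 0 < e / 3 by rewrite divr_gt0.
apply: filterS (Fl _ e3) => x xl.
rewrite (_ : e = 3 * (e / 3)); last by field.
by apply: jl_norm_le => u; rewrite distrC.
Qed.

HB.instance Definition _ := Uniform_isComplete.Build jl jl_complete.

End Space.
Arguments jl R : clear implicits.


(** * Strict convexity *)

Section Results.
Local Open Scope card_scope.
Context {R : realType}.
Implicit Types (x y : jl R).

Lemma jl_strictly_convex : strictly_convex_norm (jl R).
Proof.
move=> x y x0 y0; rewrite !jl_normE => xy.
have [bx bY] := (bnd_jl x, bnd_jl y).
have hpos z : z != 0 -> 0 < hnorm (z : jl R).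
  move=> z0; rewrite lt_def hnorm_ge0 andbT; apply: contraNN z0 => /eqP z0.
  by apply/eqP/val_inj/hnorm_eq0 => //; exact: bnd_jl.
(* Both summands of the norm are subadditive, so equality for their sum forces equality for each. *)
have : hnorm (x + y) = hnorm x + hnorm y.
  by have := sup_normD bx bY; have := hnormD bx bY; move: xy => /=; lra.
move=> /(hnorm_strict bx bY) E.
exists (hnorm x / hnorm y); first by rewrite divr_gt0// hpos.
apply: val_inj => /=; rewrite mulrC -[RHS]scalerA -E scalerA mulVf ?scale1r//.
by rewrite gt_eqF// hpos.
Qed.

(** * Density continuum *)

Lemma jl_indic_subproof s : (fun u => (on_branch s u)%:R : R) \in jl_pred.
Proof.
apply/jl_predP; split; last exact: branching_indic.
by exists 1 => u; case: on_branch; rewrite ?normr1 ?normr0.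
Qed.

Definition jl_indic s : jl R := JL (jl_indic_subproof s).

Lemma jl_indic_separated s t : s <> t -> 1 <= `|jl_indic s - jl_indic t|.
Proof.
move=> st; have [n Hn] := on_branch_disjoint st; set u := mkseq s n.
have su : on_branch s u by rewrite /on_branch size_mkseq.
have tu : ~~ on_branch t u by have := Hn u; rewrite size_mkseq leqnn su => /(_ isT).
rewrite (le_trans _ (jl_norm_ge _ u))//.
change (1 <= `|(on_branch s u)%:R - (on_branch t u)%:R : R|).
by rewrite su (negbTE tu) subr0 normr1.
Qed.

(** The Dedekind cut of [r], read along an enumeration of the rationals, so that each real yields a
    branch. *)
Definition rational_cut (r : R) : nat -> bool := fun k =>
  oapp (fun q : rat => ratr q < r) false (choice.unpickle k).

Lemma rational_cut_inj : injective rational_cut.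
Proof.
suff lt_cut (r r' : R) : r < r' -> rational_cut r <> rational_cut r'.
  by move=> r r' rr'; have [/lt_cut/(_ rr')|/lt_cut/(_ (esym rr'))|] := ltgtP r r'.
move=> /rat_in_itvoo[q]; rewrite in_itv/= => /andP[rq qr'].
move=> /(congr1 (@^~ (choice.pickle q))); rewrite /rational_cut choice.pickleK /=.
by rewrite qr' ltNge (ltW rq).
Qed.

(** The cuts of all coordinates are merged into one binary sequence, which embeds the space in [R]
    as a set. *)
Definition jl_code x : R := binary_sum (fun k =>
  oapp (fun p : nat * nat => rational_cut (coord x p.1) p.2) false
    (choice.unpickle k)).

Lemma jl_code_inj : injective jl_code.
Proof.
move=> x y /binary_sum_inj xy; apply/val_inj/funext => u.
rewrite -!coord_pickle; apply/rational_cut_inj/funext => k.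
move: xy => /(congr1 (@^~ (choice.pickle (choice.pickle u, k)))).
by rewrite !choice.pickleK.
Qed.

(** Indicators of distinct branches are 1-separated, so a dense set has distinct points in the balls
    of radius one half around them. Conversely, the whole space injects into [R] by [jl_code]. *)
Lemma jl_density : has_density (jl R) [set: R].
Proof.
have RD (D : set (jl R)) : dense D -> [set: R] #<= D.
  move=> dD.
  have /choice[f Hf] : forall r, exists x,
      D x /\ `|jl_indic (rational_cut r) - x| < 1 / 2.
    move=> r; have [||x [xb Dx]] := dD (ball (jl_indic (rational_cut r)) (1 / 2)).
    - exists (jl_indic (rational_cut r)); apply: ballxx; lra.
    - apply: ball_open; lra.
    by exists x; split=> //; move: xb; rewrite -ball_normE.
  apply/pcard_leP/injfunPex; exists f => [r _|r r' _ _ ff'].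
    by have [] := Hf r.
  apply: contrapT => rr'.
  have /jl_indic_separated : rational_cut r <> rational_cut r'.
    by move/rational_cut_inj.
  have [_ H] := Hf r; have [_ H'] := Hf r'; rewrite leNgt => /negP; apply.
  rewrite (le_lt_trans (ler_distD (f r) _ _))// [ltRHS]splitr ltrD//.
  by rewrite ff' distrC.
have dT : dense [set: jl R] by move=> O [x Ox] _; exists x.
split=> //; exists [set: jl R]; split=> //; rewrite card_eq_le RD// andbT.
by apply/pcard_injP; exists jl_code => x y _ _; exact: jl_code_inj.
Qed.

(** * Countable coding of the unit sphere *)

Lemma floor_dist (a b d : R) : 0 < d -> Num.floor (a / d) = Num.floor (b / d) ->
  `|a - b| <= d.
Proof.
move=> d0 ab; have dn : d != 0 by rewrite gt_eqF.
have la := Num.Theory.floor_le (a / d); have ra := Num.Theory.floorD1_gt (a / d).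
have lb := Num.Theory.floor_le (b / d); have rb := Num.Theory.floorD1_gt (b / d).
rewrite ab in la ra; move: la ra lb rb; rewrite !intrD.
set m : R := _%:~R => la ra lb rb.
rewrite -[a](divfK dn) -[b](divfK dn) -mulrBl normrM (gtr0_norm d0).
by rewrite ger_pMl// ler_norml; lra.
Qed.

(** An accuracy, a level of the tree and finitely many rounded coordinates: a countable type. *)
Definition sphere_code := (nat * nat * seq int)%type.

Definition grain k : R := k.+1%:R^-1.

(* The lower bound on [size q] makes the tail of the series defining [inner]
   negligible against [grain k ^+ 2]. *)
Definition has_code x (c : sphere_code) :=
  let: (k, L, q) := c in
  [/\ 8 * grain k < hnorm x, tree_approx x (grain k) L,
      (6 * k.+1 ^ 2 <= size q)%N,
      forall u : seq bool, (size u <= L)%N -> (choice.pickle u < size q)%N &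
      q = mkseq (fun i => Num.floor (coord x i / grain k)) (size q)].

Lemma grain_gt0 k : 0 < grain k. Proof. by rewrite invr_gt0. Qed.

Lemma exists_code x : x != 0 -> exists c, has_code x c.
Proof.
move=> x0; have hx : 0 < hnorm x / 8.
  rewrite divr_gt0// lt_def hnorm_ge0 andbT; apply: contraNN x0 => /eqP x0.
  by apply/eqP/val_inj/hnorm_eq0 => //; exact: bnd_jl.
have [k _ /(_ _ (leqnn k)) /= kx] := near_infty_natSinv_lt (PosNum hx).
have [L xL] := branching_jl x (grain_gt0 k).
have [M pM] := bounded_on_levels choice.pickle L.
(* The length serves the tail estimate and exceeds the index of every node up to level [L]. *)
pose q := mkseq (fun i => Num.floor (coord x i / grain k)) (maxn (6 * k.+1 ^ 2) M.+1).
exists (k, L, q); split => //; rewrite ?size_mkseq ?leq_maxl//.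
- by rewrite mulrC -ltr_pdivlMr.
- by move=> u /pM; rewrite leq_max ltnS orbC => ->.
Qed.

Lemma has_code_coord x y k L q i : has_code x (k, L, q) -> has_code y (k, L, q) ->
  (i < size q)%N -> `|coord x i - coord y i| <= grain k.
Proof.
move=> [_ _ _ _ qx] [_ _ _ _ qy] iq; apply: floor_dist (grain_gt0 k) _.
have := congr1 (nth 0 ^~ i) (etrans (esym qx) qy).
by rewrite !nth_mkseq.
Qed.

(** Follows from [M < 3 ^ M]. The factor 6 is [2 ^ 2 * (3 / 2)]: differences of unit vectors have
    values at most 2, and [3 / 2] comes from [inner_le]. *)
Lemma exp3_grain k M : (6 * k.+1 ^ 2 <= M)%N ->
  6 * 3^-1 ^+ M <= grain k ^+ 2 :> R.
Proof.
move=> kM; have kM3 : (6 * k.+1 ^ 2 <= 3 ^ M)%N.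
  by rewrite (leq_trans kM)// ltnW// ltn_expl.
rewrite exprVn /grain exprVn -[leRHS]mul1r ler_pdivlMr ?exprn_gt0//.
rewrite mulrAC ler_pdivrMr ?exprn_gt0// mul1r.
by rewrite -!natrX -natrM ler_nat.
Qed.

(* Within one class, a value [r] of [x] along a branch can only be moved to
   another branch, so [x - y] takes there values close to [r], [-r] or [0]:
   its sup norm does not exceed that of [x], which is [1 - hnorm x]. *)
Lemma same_code_close x y c : `|x| = 1 -> `|y| = 1 ->
  has_code x c -> has_code y c -> `|x - y| < 1.
Proof.
case: c => [[k L] q] x1 y1 cx cy.
have cxy := has_code_coord cx cy; move: cx cy cxy; rewrite /has_code.
have := grain_gt0 k; have := @exp3_grain k (size q); set d := grain k.
move=> dq d0 [hx xL kq Lq _] [hy yL _ _ _] cxy; have {}dq := dq kq.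
have [bx bY] := (bnd_jl x, bnd_jl y).
have sx u : `|x u| <= 1 - 8 * d.
  by have := le_sup_norm u bx; move: x1; rewrite jl_normE; lra.
have sy u : `|y u| <= 1 - 8 * d.
  by have := le_sup_norm u bY; move: y1; rewrite jl_normE; lra.
have d8 : 8 * d <= 1 by have := sx [::]; have := normr_ge0 (x [::]); lra.
have shallow u : (size u <= L)%N -> `|x u - y u| <= d.
  by move=> /Lq /cxy; rewrite !coord_pickle.
have sxy : sup_norm (x - y) <= 1 - 3 * d.
  apply: sup_norm_le => u; change (`|x u - y u| <= 1 - 3 * d).
  have [/shallow|Lu] := leqP (size u) L; first lra.
  have tL : size (take L u) = L by rewrite size_takel// ltnW.
  (* The node [take L u] lies on both branches, and [x], [y] differ there by at most [d], so [r] and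
     [r'] differ by at most [3 * d]. If [u] is on both branches, the bound is [5 * d <= 1 - 3 * d];
     on one, [1 - 5 * d]; on none, [2 * d]. *)
  have := shallow (take L u); rewrite tL => /(_ (leqnn _)).
  have [s [r [st Hr]]] := xL _ tL; have [s' [r' [st' Hr']]] := yL _ tL.
  have := Hr (drop L u); have := Hr' (drop L u); rewrite cat_take_drop.
  have := Hr [::]; have := Hr' [::]; rewrite cats0 st st' !mulr1.
  have := sx (take L u); have := sy (take L u).
  rewrite !ler_norml.
  by case: (on_branch s u); case: (on_branch s' u); rewrite ?mulr1 ?mulr0; lra.
(* The square is at most [d ^+ 2 * (3 / 2)] plus a tail of at most [d ^+ 2]. *)
have hxy : hnorm (x - y) <= 2 * d.
  have xy2 u : `|(x - y : jl R) u| <= 2.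
    change (`|x u - y u| <= 2); rewrite (le_trans (ler_normB _ _))//.
    by have := sx u; have := sy u; lra.
  have cxyd i : (i < size q)%N -> `|coord (x - y : jl R) i| <= d.
    move=> /cxy; suff -> : coord (x - y : jl R) i = coord x i - coord y i by [].
    by rewrite /coord; case: choice.unpickle => //=; rewrite subr0.
  have := inner_le (ltW d0) xy2 cxyd.
  rewrite -[2 * d]ger0_norm; last by lra.
  rewrite -sqrtr_sqr => H; rewrite ler_wsqrtr// (le_trans H)// exprMn.
  by have := sqr_ge0 d; lra.
by rewrite jl_normE; lra.
Qed.

(** * Auerbach systems *)

Lemma dual_norm_le (X : normedModType R) (f : {linear X -> R^o}) (x : X) :
  dual_norm f = 1 -> `|f x| <= `|x|.
Proof.
move=> f1; have [x0|x0] := eqVneq x 0; first by rewrite x0 linear0 !normr0.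
have nx : 0 < `|x| by rewrite normr_gt0.
(* Without a supremum [sup] would take its default value 0, contrary to dual norm 1. *)
have : has_sup [set `|f y| | y in [set y : X | `|y| <= 1]].
  apply: contrapT => /sup_out E; move: f1; rewrite /dual_norm E => /esym/eqP.
  by rewrite oner_eq0.
move=> /sup_upper_bound/(_ `|f (`|x|^-1 *: x)|); rewrite -/(dual_norm f) f1.
rewrite linearZ normrM gtr0_norm ?invr_gt0// ler_pdivrMl// mulr1; apply.
exists (`|x|^-1 *: x); last by rewrite linearZ normrM gtr0_norm ?invr_gt0.
by rewrite /= normrZ gtr0_norm ?invr_gt0// mulVf// gt_eqF.
Qed.

Lemma auerbach_separated (X : normedModType R) (I : Type) (x : I -> X)
    (f : I -> {linear X -> R^o}) i j :
  auerbach_system x f -> i <> j -> 1 <= `|x i - x j|.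
Proof.
move=> [[_ f0 f1] xf] ij; have [_ fi] := xf i.
rewrite (le_trans _ (dual_norm_le _ fi))// linearB f1 f0; first by rewrite subr0 normr1.
by move=> ji; exact: ij.
Qed.

Lemma jl_no_auerbach (I : Type) (x : I -> jl R) (f : I -> {linear jl R -> R^o}) :
  auerbach_system x f -> countable [set: I].
Proof.
move=> xf; have x1 i : `|x i| = 1 by case: xf => _ /(_ i)[].
have /choice[c xc] : forall i, exists c, has_code (x i) c.
  by move=> i; apply: exists_code; rewrite -normr_gt0 x1.
(* Equal codes at distinct indices would put two vectors of the system at distance below 1. *)
apply/countable_injP; exists (choice.pickle \o c) => i j _ _ /= /(pcan_inj choice.pickleK) cij.
apply: contrapT => /(auerbach_separated xf); rewrite leNgt => /negP; apply.
by apply: (@same_code_close _ _ (c i)); rewrite ?x1// cij.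
Qed.

End Results.

Theorem theorem3 (R : realType) :
  exists X : completeNormedModType R,
    [/\ strictly_convex_norm X,
        has_density X [set: R] &
        ~ (exists (I : Type) (x : I -> X) (f : I -> {linear X -> R^o}),
             ~ countable [set: I] /\ auerbach_system x f)].
Proof.
exists (jl R); split; [exact: jl_strictly_convex|exact: jl_density|].
by move=> [I [x [f [Inc /jl_no_auerbach]]]].
Qed.
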